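(* Let $d\geq 2$ and let $S$ be a special Danielewski surface over the affine line with $d$ origins, given by data $(n;\sigma_1,\ldots,\sigma_d)$. Let $P\in\mathbb{C}[Z]$ be a polynomial of degree $d$ with simple roots $r_1,\ldots,r_d$, let $W\subset\mathbb{A}^3$ be the hypersurface $XY=P(Z)$, let $f\in\mathbb{C}[S]$ be a regular function with $f|_{\ell_i}=r_i$ for all $1\leq i\leq d$, and let $g(x,t)\in\mathbb{C}[x,t]$ satisfy $g(x,r_i+xt)\equiv\sigma_i(x)\pmod{x^n}$ in $\mathbb{C}[x,t]$ for all $1\leq i\leq d$. Let $\Phi\colon\mathbb{C}[W\times\mathbb{A}^1]\to\mathbb{C}[S][\alpha]$ be the isomorphism described in the context. Then, for every constant $\lambda\in\mathbb{C}$, the surface $S$ is isomorphic to the surface in $\mathbb{A}^4=\mathrm{Spec}(\mathbb{C}[x,y,z,w])$ defined by the equations $$xy=P(z)\quad\text{and}\quad\Phi^{-1}(\alpha)=\lambda .$$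
   Context: All varieties are over $\mathbb{C}$. A special Danielewski surface over the affine line with $d\geq2$ origins (equivalently, a Danielewski surface that is a principal $(\mathbb{C},+)$-bundle over this line) is constructed from the data of an integer $n\geq1$ and distinct polynomials $\sigma_1(x),\ldots,\sigma_d(x)\in\mathbb{C}[x]$, each of degree strictly smaller than $n$, as follows: $S$ is the surface obtained by gluing $d$ copies $\mathcal{U}_i=\mathrm{Spec}(\mathbb{C}[x,u_i])$, $1\leq i\leq d$, of $\mathbb{A}^2$ along the open subsets $\mathcal{U}_i^*=\mathrm{Spec}(\mathbb{C}[x,x^{-1},u_i])$ by means of the transition functions $$\mathcal{U}_i^*\to\mathcal{U}_j^*,\qquad (x,u_i)\mapsto\Big(x,\,u_i+\frac{\sigma_i(x)-\sigma_j(x)}{x^n}\Big).$$ Every such surface is affine, and $x$ is a regular function on it. The inclusion $\mathbb{C}[x]\hookrightarrow\mathbb{C}[S]$ defines an $\mathbb{A}^1$-fibration $\pi\colon S\to\mathbb{A}^1$ whose unique special fiber is $\pi^{-1}(0)=\coprod_{i=1}^d\ell_i$, where $\ell_i=\{x=0\}\subset\mathcal{U}_i$ is isomorphic to $\mathbb{A}^1$. The regular function $u\in\mathbb{C}[S]$ is defined by $u|_{\mathcal{U}_i}=x^nu_i+\sigma_i(x)\in\mathbb{C}[x,u_i]$ for all $1\leq i\leq d$. Write $\mathbb{C}[W\times\mathbb{A}^1]=\mathbb{C}[x,y,z,w]/(xy-P(z))$ and let $\mathbb{C}[S\times\mathbb{A}^1]=\mathbb{C}[S][\alpha]$ be the polynomial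 ring in one variable $\alpha$ over $\mathbb{C}[S]$. The map $\Phi$ is the $\mathbb{C}$-algebra isomorphism $\mathbb{C}[W\times\mathbb{A}^1]\to\mathbb{C}[S][\alpha]$ defined by $$\Phi(x)=x,\qquad \Phi(z)=f+x\alpha,\qquad \Phi(y)=\frac{P(f+x\alpha)}{x},\qquad \Phi(w)=\frac{u-g(x,f+x\alpha)}{x^n}.$$ The equation $\Phi^{-1}(\alpha)=\lambda$ is understood as an equation on $W\times\mathbb{A}^1=\{xy=P(z)\}\subset\mathbb{A}^4$ (equivalently, represent $\Phi^{-1}(\alpha)$ by any polynomial in $\mathbb{C}[x,y,z,w]$). *)

(* Defs.v *)
From HB Require Import structures.
From mathcomp Require Import all_boot all_order all_algebra.
From mathcomp Require boolp.
From mathcomp Require Import mpoly.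
Set Implicit Arguments.
Unset Strict Implicit.
Unset Printing Implicit Defensive.
Import GRing.Theory.
Local Open Scope ring_scope.
Local Open Scope quotient_scope.

(* A variety over an algebraically closed field k is represented by its set of
   closed points, its Zariski topology and its sheaf of k-valued regular
   functions: [regular U h] means that the restriction of h to the open set U
   is a regular function on U. *)
Record space_with_functions (k : Type) := SpaceWithFunctions {
  points :> Type;
  zopen : (points -> Prop) -> Prop;
  regular : (points -> Prop) -> (points -> k) -> Prop }.

Definition isomorphic (k : Type) (X Y : space_with_functions k) : Prop :=
  exists (phi : X -> Y) (psi : Y -> X),
    [/\ cancel phi psi, cancel psi phi,
        forall U : Y -> Prop, zopen U <-> zopen (fun x => U (phi x))
      & forall (U : Y -> Prop) (h : Y -> k), zopen U ->
          (regular U h <-> regular (fun x => U (phi x)) (fun x => h (phi x)))].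

Section Affine.
Variable k : fieldType.

Definition ideal_gen (R : comNzRingType) (E : seq R) (p : R) : Prop :=
  exists c : 'I_(size E) -> R, p = \sum_(i < size E) c i * E`_i.

(* Structure induced on T by a map e to the affine space A^m: an open set is
   the complement of the common zeros of a family of polynomials, and a regular
   function is locally a quotient of two polynomials. *)
Definition induced_from_affine (T : Type) (m : nat)
    (e : T -> {ffun 'I_m -> k}) : space_with_functions k :=
  @SpaceWithFunctions k T
    (fun U => exists F : {mpoly k[m]} -> Prop,
       forall v, U v <-> exists2 p, F p & p.@[e v] != 0)
    (fun U h => forall v, U v -> exists a b : {mpoly k[m]},
       b.@[e v] != 0 /\
       forall w, U w -> b.@[e w] != 0 -> h w = a.@[e w] / b.@[e w]).

Definition affine_space (m : nat) : space_with_functions k :=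
  @induced_from_affine {ffun 'I_m -> k} m id.

Definition in_zero_locus (m : nat) (E : seq {mpoly k[m]})
    (v : {ffun 'I_m -> k}) : bool := all (fun p => p.@[v] == 0) E.

Definition zero_locus (m : nat) (E : seq {mpoly k[m]}) :
    space_with_functions k :=
  @induced_from_affine {v | in_zero_locus E v} m val.

(* X is isomorphic to the closed subscheme of A^m defined by the equations
   E = 0: X being a variety, this means that X is isomorphic to the zero locus
   of E and that E generates the whole ideal of this zero locus. *)
Definition isomorphic_to_subscheme (X : space_with_functions k) (m : nat)
    (E : seq {mpoly k[m]}) : Prop :=
  isomorphic X (zero_locus E) /\
  forall p : {mpoly k[m]},
    (forall v, in_zero_locus E v -> p.@[v] = 0) -> ideal_gen E p.

End Affine.

Record danielewski_data (k : fieldType) := DanielewskiData {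
  origins : nat;
  xdeg : nat;
  sigma : 'I_origins -> {poly k};
  origins_ge2 : (2 <= origins)%N;
  xdeg_ge1 : (1 <= xdeg)%N;
  sigma_inj : injective sigma;
  sigma_deg : forall i, (size (sigma i) <= xdeg)%N }.

Section Surface.
Variables (k : fieldType) (D : danielewski_data k).
Local Notation d := (origins D).
Local Notation n := (xdeg D).
Local Notation s := (@sigma k D).

(* The point (x, u_i) of the chart U_i is (i, v) with v 0 = x, v 1 = u_i. *)
Local Notation chart_point := ('I_d * {ffun 'I_2 -> k})%type.

Definition glue (p q : chart_point) : bool :=
  (p == q) ||
  [&& p.2 0 != 0, q.2 0 == p.2 0
    & q.2 1 == p.2 1 + ((s p.1).[p.2 0] - (s q.1).[p.2 0]) / p.2 0 ^+ n].

Lemma glue_refl : reflexive glue.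
Proof. by move=> p; rewrite /glue eqxx. Qed.

Lemma glue_sym : ssrbool.symmetric glue.
Proof.
suff H p q : glue p q -> glue q p by move=> p q; apply/idP/idP; apply: H.
rewrite /glue; case/orP=> [/eqP->|/and3P[nz /eqP e0 /eqP e1]].
  by rewrite eqxx.
apply/orP; right; rewrite e0 nz eqxx e1 /= -addrA -mulrDl.
by rewrite addrC [X in X / _](_ : _ = 0) ?mul0r ?add0r // addrC subrKA subrr.
Qed.

Lemma glue_trans : transitive glue.
Proof.
move=> q p t; rewrite /glue; case/orP=> [/eqP->//|/and3P[nz /eqP e0 /eqP e1]].
case/orP=> [/eqP<-|/and3P[_ /eqP e2 /eqP e3]].
  by rewrite nz e0 e1 !eqxx orbT.
apply/orP; right; rewrite nz e2 e0 eqxx e3 e1 e0 /= -addrA -mulrDl.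
by rewrite addrA subrK.
Qed.

Canonical glue_equiv := EquivRel glue glue_refl glue_sym glue_trans.

Definition surface_points : Type := {eq_quot glue_equiv}.
Definition chart (i : 'I_d) (v : affine_space k 2) : surface_points :=
  \pi_{eq_quot glue_equiv} ((i, v) : chart_point).

Definition surface : space_with_functions k :=
  @SpaceWithFunctions k surface_points
    (fun U => forall i, zopen (fun v => U (chart i v)))
    (fun U h => forall i,
       regular (fun v => U (chart i v)) (fun v => h (chart i v))).

(* h_i(x, u) = h_j(x, u + (s_i - s_j)/x^n), where iota embeds k[x] in a field
   K; C[x, u_i] is {poly {poly k}}: polynomials in u_i over k[x]. *)
Section CompatibleIn.
Variables (K : fieldType) (iota : {rmorphism {poly k} -> K}).

Definition transition (i j : 'I_d) : K := iota (s i - s j) / iota ('X^n).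

Definition compatible_in (h : {ffun 'I_d -> {poly {poly k}}}) : bool :=
  [forall i, forall j, map_poly iota (h i) ==
     map_poly iota (h j) \Po ('X + (transition i j)%:P)].

Lemma compatible_inP (h : {ffun 'I_d -> {poly {poly k}}}) : reflect
  (forall i j, map_poly iota (h i) =
     map_poly iota (h j) \Po ('X + (transition i j)%:P)) (compatible_in h).
Proof.
apply: (iffP forallP) => [H i j|H i]; first exact/eqP/(forallP (H i)).
by apply/forallP=> j; apply/eqP.
Qed.

Lemma compatible_in_subring : subring_closed compatible_in.
Proof.
split=> [|a b /compatible_inP Ha /compatible_inP Hb|
          a b /compatible_inP Ha /compatible_inP Hb];
  apply/compatible_inP=> i j; rewrite !ffunE.
- by rewrite rmorph1 comp_polyC.
- by rewrite [LHS]rmorphB /= (Ha i j) (Hb i j) -comp_polyB -(rmorphB (map_poly iota)).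
- by rewrite [LHS]rmorphM /= (Ha i j) (Hb i j) -comp_polyM -(rmorphM (map_poly iota)).
Qed.

Lemma pull_x_compatible_in (a : {poly k}) : compatible_in [ffun=> a%:P].
Proof. by apply/compatible_inP=> i j; rewrite !ffunE map_polyC comp_polyC. Qed.

Lemma u_compatible_in : injective iota ->
  compatible_in [ffun i => ('X^n)%:P * 'X + (s i)%:P].
Proof.
move=> inj; apply/compatible_inP=> i j; rewrite !ffunE.
have E t : map_poly iota (('X^n)%:P * 'X + t%:P) =
    (iota 'X^n)%:P * 'X + (iota t)%:P.
  by rewrite rmorphD rmorphM /= !map_polyC map_polyX.
have nz : iota 'X^n != 0.
  by rewrite -(rmorph0 iota) (inj_eq inj) monic_neq0 ?monicXn.
rewrite !E comp_polyD comp_polyM !comp_polyC comp_polyX mulrDr -addrA.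
congr (_ + _); rewrite -polyCM -polyCD; congr (_%:P).
by rewrite /transition mulrCA divff // mulr1 rmorphB subrK.
Qed.

End CompatibleIn.

(* An identity between Laurent polynomials in x, read in k(x)[u]. *)
Definition compatible : {pred {ffun 'I_d -> {poly {poly k}}}} :=
  compatible_in (@tofrac {poly k}).

Lemma compatible_subring : subring_closed compatible.
Proof. exact: compatible_in_subring. Qed.

HB.instance Definition _ := GRing.isSubringClosed.Build
  {ffun 'I_d -> {poly {poly k}}} compatible compatible_subring.

(* C[S]: families of polynomials on the charts that agree on the overlaps. *)
Record coord_ring := CoordRing {
  charts :> {ffun 'I_d -> {poly {poly k}}};
  chartsP : charts \in compatible }.

HB.instance Definition _ := [isSub for charts].
HB.instance Definition _ := [Choice of coord_ring by <:].
HB.instance Definition _ := GRing.SubChoice_isSubPzRing.Build _ _ coord_ring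
  compatible_subring.

Lemma coord_ring_mulC : commutative (@GRing.mul coord_ring).
Proof.
by move=> a b; apply/val_inj/ffunP=> i; rewrite !rmorphM /= !ffunE mulrC.
Qed.

Lemma coord_ring_oner_neq0 : (1 : coord_ring) != 0.
Proof.
apply/eqP=> /(congr1 charts)/ffunP/(_ (Ordinal (ltnW (origins_ge2 D)))).
by rewrite !ffunE => /eqP; rewrite oner_eq0.
Qed.

HB.instance Definition _ :=
  GRing.PzSemiRing_isNonZero.Build coord_ring coord_ring_oner_neq0.
HB.instance Definition _ :=
  GRing.PzRing_hasCommutativeMul.Build coord_ring coord_ring_mulC.

Lemma pull_x_compatible (a : {poly k}) : [ffun=> a%:P] \in compatible.
Proof. exact: pull_x_compatible_in. Qed.

(* The inclusion of C[x] in C[S]. *)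
Definition pull_x (a : {poly k}) : coord_ring := CoordRing (pull_x_compatible a).

Lemma u_compatible : [ffun i => ('X^n)%:P * 'X + (s i)%:P] \in compatible.
Proof. apply: u_compatible_in; by move=> p q /eqP; rewrite tofrac_eq => /eqP. Qed.

Definition u_fun : coord_ring := CoordRing u_compatible.

Definition restrict_line (h : coord_ring) (i : 'I_d) : {poly k} :=
  map_poly (fun a : {poly k} => a.[0]) (h i).

Section Phi.
Variables (P : {poly k}) (f : coord_ring) (g : {poly {poly k}}).

(* q / x^m in C[S][alpha]; x is not a zero divisor, so the quotient is unique
   when it exists. *)
Definition div_x (m : nat) (q : {poly coord_ring}) : {poly coord_ring} :=
  if boolp.pselect (exists p, (pull_x 'X)%:P ^+ m * p = q) is left e
  then projT1 (boolp.cid e) else 0.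

Definition Phi_z : {poly coord_ring} := f%:P + (pull_x 'X)%:P * 'X.

Definition Phi_y : {poly coord_ring} :=
  div_x 1 (map_poly (fun c => (pull_x c%:P)%:P) P).[Phi_z].

Definition Phi_w : {poly coord_ring} :=
  div_x n (u_fun%:P - (map_poly (fun a => (pull_x a)%:P) g).[Phi_z]).

(* Substitution in C[x,y,z,w]; the variables are numbered in this order. *)
Definition Phi (F : {mpoly k[4]}) : {poly coord_ring} :=
  mmap (fun c => (pull_x c%:P)%:P)
       (fun i : 'I_4 => [:: (pull_x 'X)%:P; Phi_y; Phi_z; Phi_w]`_i) F.

End Phi.

End Surface.

Definition eq_W (k : fieldType) (P : {poly k}) : {mpoly k[4]} :=
  'X_(@Ordinal 4 0 isT) * 'X_(@Ordinal 4 1 isT)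
  - (map_poly (@mpolyC 4 k) P).['X_(@Ordinal 4 2 isT)].

(* For a ring morphism phi, this says that phi factors through an isomorphism
   A/(E) -> B. *)
Definition induces_iso (A B : comNzRingType) (E : seq A) (phi : A -> B) : Prop :=
  (forall b, exists a, phi a = b) /\
  (forall a, phi a = 0 <-> ideal_gen E a).

(* Main.v *)
Require Import Defs.
From HB Require Import structures.
From mathcomp Require Import all_boot all_order all_algebra.
From mathcomp Require Import reals complex mpoly.
From mathcomp Require Import ring.
Set Implicit Arguments.
Unset Strict Implicit.
Unset Printing Implicit Defensive.
Import GRing.Theory.
Local Open Scope ring_scope.

(* Sending (s, a) to the values of Phi x, Phi y, Phi z, Phi w at s and
   alpha = a is a bijection from S x A^1 onto the points of W x A^1.  Where x
   is nonzero this is clear; on the i-th chart at x = 0, writing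
   f = r_i + x f_i and g(x, r_i + x t) = sigma_i + x^n q_i(x, t), it reads
     (u_i, a) |-> (0, P'(r_i) (f_i + a), r_i, u_i - q_i(0, f_i + a)),
   a triangular automorphism of the plane for each i.  So if Phi F is divisible
   by x, then F vanishes where x = P(z) = 0 and lies in (x, P(z)), that is, in
   (x) modulo xy - P(z); as Phi is onto after inverting x, it is onto.  Its
   kernel consists of the F that vanish on W x A^1, hence is generated by
   xy - P(z).  The slice alpha = lambda gives the isomorphism of S with the
   surface, and charts are matched through functions of C[S] divisible by x on
   every other chart, which localize S inside one chart. *)

(** * Polynomials over an infinite field *)

Lemma mpoly_ring_ind (n : nat) (R : comNzRingType) (Q : {mpoly R[n]} -> Prop) :
  (forall c, Q c%:MP) -> (forall i, Q 'X_i) ->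
  (forall p q, Q p -> Q q -> Q (p + q)) ->
  (forall p q, Q p -> Q q -> Q (p * q)) -> forall p, Q p.
Proof.
move=> QC QX QD QM; elim/mpolyind=> [|c m p _ _ Qp].
  by rewrite -mpolyC0; apply: QC.
apply: (QD) => //; rewrite -mul_mpolyC; apply: (QM) => //.
rewrite mpolyXE_id; apply: (big_ind Q) => [||i _].
- by rewrite -mpolyC1; apply: (QC).
- exact: QM.
elim: (m i) => [|j IH]; first by rewrite expr0 -mpolyC1; apply: QC.
by rewrite exprS; apply: QM.
Qed.

Lemma mpoly_rmorph_ext (n : nat) (R : comNzRingType) (S : nzRingType)
    (phi psi : {rmorphism {mpoly R[n]} -> S}) :
  (forall c, phi c%:MP = psi c%:MP) -> (forall i, phi 'X_i = psi 'X_i) ->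
  phi =1 psi.
Proof.
move=> eqC eqX; elim/mpoly_ring_ind=> // p q IHp IHq.
  by rewrite !rmorphD IHp IHq.
by rewrite !rmorphM IHp IHq.
Qed.

(** Division by ['X_i - c] with any variable as the main one. The remainder is a substitution, hence
    a ring morphism, so only the generators have to be checked. *)
Lemma mpoly_sub_subst (n : nat) (R : comNzRingType) (i : 'I_n) (c : R)
    (p : {mpoly R[n]}) :
  exists q, p = p \mPo [tuple if j == i then c%:MP else 'X_j | j < n]
                + ('X_i - c%:MP) * q.
Proof.
set lq := mktuple _.
elim/mpoly_ring_ind: p => [b|j|p q [s Hs] [t Ht]|p q [s Hs] [t Ht]].
- by exists 0; rewrite comp_mpolyC mulr0 addr0.
- exists (j == i)%:R; rewrite comp_mpolyXU -tnth_nth tnth_mktuple.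
  by case: eqP => [->|_]; rewrite ?mulr1 ?mulr0 ?addr0 // addrC subrK.
- by exists (s + t); rewrite rmorphD /= {1}Hs {1}Ht; ring.
(* With p' and q' the substituted polynomials, pq - p'q' = (p - p')q + p'(q - q'). *)
- exists (s * q + (p \mPo lq) * t).
  by rewrite rmorphM /= {1}Hs mulrDl {1}Ht; ring.
Qed.

Lemma mpolyXi_neq0 (n : nat) (R : comNzRingType) (i : 'I_n) :
  'X_i != 0 :> {mpoly R[n]}.
Proof.
apply/eqP=> /(congr1 (meval (fun=> 1)))/eqP.
by rewrite mevalXU meval0 oner_eq0.
Qed.

Section InfiniteField.
Variable k : fieldType.
Hypothesis k_inf : forall s : seq k, exists x, x \notin s.

(** The embedding [e] allows coefficients in a larger domain, such as k[x], while the test points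
    stay in k. *)
Lemma poly_eq0_infinite (R : idomainType) (e : k -> R) (p : {poly R}) :
  injective e -> (forall x, p.[e x] = 0) -> p = 0.
Proof.
move=> e_inj p0.
have [s [us ss]] : exists s : seq k, uniq s /\ size s = size p.
  elim: (size p) => [|m [s [us <-]]]; first by exists [::].
  by have [x xs] := k_inf s; exists (x :: s); rewrite /= xs us.
apply/eqP/negbNE/negP=> nz.
have := max_poly_roots (rs := map e s) nz.
rewrite size_map ss ltnn => /(_ _ _)/negP; apply=> //.
  by apply/allP=> _ /mapP[x _ ->]; rewrite /root p0.
by rewrite map_inj_uniq.
Qed.

(** Induction on the number of variables: [muni] reads p as a polynomial in the last variable, whose
    coefficients vanish by induction. *)
Lemma mpoly_eq0_infinite (n : nat) (p : {mpoly k[n]}) :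
  (forall v, p.@[v] = 0) -> p = 0.
Proof.
elim: n p => [|n IH] p p0.
  have [c pc] : exists c, p = c%:MP.
    elim/mpoly_ring_ind: {p0} p => [c|[]|p q [a ->] [b ->]|p q [a ->] [b ->]] //.
    - by exists c.
    - by exists (a + b); rewrite mpolyCD.
    - by exists (a * b); rewrite mpolyCM.
  by move: (p0 (fun=> 0)); rewrite pc mevalC => ->.
pose join v c (i : 'I_n.+1) : k :=
  if split (cast_ord (esym (addn1 n)) i) is inl j then v j else c.
have muni_eval v c : (map_poly (meval v) (muni p)).[c] = p.@[join v c].
  pose ev := horner_eval c \o map_poly (meval v) \o @muni n k.
  rewrite -[LHS]/(ev p); apply: mpoly_rmorph_ext => [b|i] /=; rewrite /horner_eval.
    by rewrite muniC map_polyC hornerC /= !mevalC.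
  rewrite mevalXU /muni mmapX mmap1U /join; case: split => j.
    by rewrite map_polyC hornerC /= mevalXU.
  by rewrite map_polyX hornerX.
have muni0 : muni p = 0.
  apply/polyP=> i; rewrite coef0; apply: IH => v.
  rewrite -coef_map (_ : map_poly _ _ = 0) ?coef0 //.
  by apply: (@poly_eq0_infinite _ id) => // c; rewrite muni_eval.
(* Substituting the last variable back recovers p, so [muni p = 0] forces p = 0. *)
pose back := horner_eval 'X_ord_max \o map_poly (@mwiden n k) \o @muni n k.
suff -> : p = back p by rewrite /back /= muni0 rmorph0 /horner_eval horner0.
apply: (@mpoly_rmorph_ext _ _ _ idfun back) => [b|i] /=; rewrite /horner_eval.
  by rewrite muniC map_polyC hornerC /= mwidenC.
rewrite /muni mmapX mmap1U; case: splitP => j /= eqj.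
  rewrite map_polyC hornerC /= /mwiden mmapX mmap1U; congr 'X__.
  exact: val_inj.
rewrite map_polyX hornerX; congr 'X__; apply: val_inj => /=.
by rewrite eqj ord1 addn0.
Qed.

End InfiniteField.
(** * Regular functions on S *)

Section CoordinateRing.
Variables (k : fieldType) (D : danielewski_data k).
Local Notation d := (origins D).
Local Notation n := (xdeg D).
Local Notation CS := (coord_ring D).

Definition chart_fun (i : 'I_d) (h : CS) : {poly {poly k}} := h i.

Lemma chart_fun_is_additive i : zmod_morphism (chart_fun i).
Proof. by move=> a b; rewrite /chart_fun [charts _](rmorphB val) !ffunE. Qed.

Lemma chart_fun_is_multiplicative i : monoid_morphism (chart_fun i).
Proof.
split=> [|a b]; rewrite /chart_fun; first by rewrite [charts _](rmorph1 val) ffunE.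
by rewrite [charts _](rmorphM val) ffunE.
Qed.

HB.instance Definition _ i := GRing.isZmodMorphism.Build CS {poly {poly k}}
  (chart_fun i) (chart_fun_is_additive i).
HB.instance Definition _ i := GRing.isMonoidMorphism.Build CS {poly {poly k}}
  (chart_fun i) (chart_fun_is_multiplicative i).

Lemma chart_funP (a b : CS) : (forall i, chart_fun i a = chart_fun i b) -> a = b.
Proof. by move=> eq_ab; apply/val_inj/ffunP. Qed.

Lemma chart_pull_x i (a : {poly k}) : chart_fun i (pull_x D a) = a%:P.
Proof. by rewrite /chart_fun ffunE. Qed.

Lemma chart_u_fun i :
  chart_fun i (u_fun D) = ('X^n)%:P * 'X + (sigma i)%:P.
Proof. by rewrite /chart_fun ffunE. Qed.

Lemma pull_x_is_additive : zmod_morphism (pull_x D).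
Proof.
by move=> a b; apply/chart_funP=> i; rewrite rmorphB /= !chart_pull_x rmorphB.
Qed.

Lemma pull_x_is_multiplicative : monoid_morphism (pull_x D).
Proof.
split=> [|a b]; apply/chart_funP=> i.
  by rewrite rmorph1 chart_pull_x.
by rewrite rmorphM /= !chart_pull_x rmorphM.
Qed.

HB.instance Definition _ := GRing.isZmodMorphism.Build {poly k} CS
  (@pull_x k D) pull_x_is_additive.
HB.instance Definition _ := GRing.isMonoidMorphism.Build {poly k} CS
  (@pull_x k D) pull_x_is_multiplicative.

Lemma chartsE (h : CS) i j : map_poly (@tofrac {poly k}) (chart_fun i h) =
  map_poly (@tofrac {poly k}) (chart_fun j h)
    \Po ('X + (transition (@tofrac {poly k}) i j)%:P).
Proof. exact: (compatible_inP _ _ (chartsP h)). Qed.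

Lemma map_tofrac_inj : injective (map_poly (@tofrac {poly k})).
Proof.
by apply: map_inj_poly => [a b /eqP|]; rewrite ?rmorph0 // tofrac_eq => /eqP.
Qed.

(** On the i-th chart x^n u_i = u - sigma_i, so a power of x turns any polynomial in u_i into one in
    u over k[x]. *)
Lemma chart_clear_x i (p : {poly {poly k}}) :
  exists (N : nat) (A : {poly {poly k}}),
    ('X^N)%:P * p = A \Po chart_fun i (u_fun D).
Proof.
elim/poly_ind: p => [|p c [N [A IH]]].
  by exists 0, 0; rewrite mulr0 comp_poly0.
exists (N + n)%N, (A * ('X - (sigma i)%:P) + ('X^(N + n) * c)%:P).
rewrite comp_polyD comp_polyM comp_polyB comp_polyX !comp_polyC -IH chart_u_fun.
rewrite exprD !polyCM; ring.
Qed.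

(** Inverting x in C[S] leaves only x and u. A relation found on one chart moves to the others
    because the transition substitution over k(x) acts on h and u alike. *)
Lemma pull_x_mul_u (h : CS) :
  exists (N : nat) (A : {poly {poly k}}), forall i,
    ('X^N)%:P * chart_fun i h = A \Po chart_fun i (u_fun D).
Proof.
pose i0 := Ordinal (ltnW (origins_ge2 D)).
have [N [A HA]] := chart_clear_x i0 (chart_fun i0 h).
exists N, A => i; apply: map_tofrac_inj.
rewrite rmorphM /= (chartsE h i i0) map_polyC /=.
rewrite map_comp_poly (chartsE (u_fun D) i i0) comp_polyA.
rewrite -map_comp_poly -HA (rmorphM (map_poly _)) /= comp_polyM /=.
by rewrite map_polyC comp_polyC.
Qed.

(** The quotients on the charts are compatible since x^m can be cancelled in k(x)[u]. *)
Lemma divide_x (h : CS) (m : nat) :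
  (forall i, exists c, chart_fun i h = ('X^m)%:P * c) ->
  exists h', h = pull_x D 'X^m * h'.
Proof.
move=> /fin_all_exists[c hc].
have comp_c : [ffun i => c i] \in compatible (D:=D).
  apply/compatible_inP=> i j; rewrite !ffunE.
  have nz : (tofrac ('X^m : {poly k}))%:P != 0.
    by rewrite polyC_eq0 tofrac_eq0 monic_neq0 // monicXn.
  apply: (mulfI nz); have := chartsE h i j.
  by rewrite !hc !rmorphM /= map_polyC /= comp_polyC.
exists (CoordRing comp_c); apply/chart_funP=> i.
by rewrite rmorphM /= chart_pull_x hc /chart_fun ffunE.
Qed.

Lemma divide_x_poly (b : {poly CS}) (m : nat) :
  (forall i, exists c, map_poly (chart_fun i) b = ('X^m)%:P%:P * c) ->
  exists p, (pull_x D 'X)%:P ^+ m * p = b.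
Proof.
move=> Hb.
have /fin_all_exists[c hc] : forall l : 'I_(size b),
    exists c, b`_l = pull_x D 'X^m * c.
  move=> l; apply: divide_x => i; have [c hc] := Hb i.
  by exists c`_l; rewrite -coef_map hc coefCM.
(* [insub] recovers the ordinal index of [c]; its default 0 is never reached for l below
   [size b]. *)
exists (\poly_(l < size b) oapp c 0 (insub l)).
apply/polyP=> l; rewrite -rmorphXn -rmorphXn /= coefCM coef_poly.
case: ltnP => lb; last by rewrite mulr0 nth_default.
by rewrite insubT /= -hc.
Qed.

Lemma mulx_inj : injective ( *%R (pull_x D 'X)%:P).
Proof.
move=> a b /polyP eq_ab; apply/polyP=> l; apply/chart_funP=> i.
have /(congr1 (chart_fun i)) := eq_ab l.
rewrite !coefCM !rmorphM /= chart_pull_x; apply: mulfI.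
by rewrite polyC_eq0 polyX_eq0.
Qed.

Lemma div_xP (m : nat) (q : {poly CS}) :
  (exists p, (pull_x D 'X)%:P ^+ m * p = q) ->
  (pull_x D 'X)%:P ^+ m * div_x m q = q.
Proof.
rewrite /div_x; case: boolp.pselect => // e _; exact: projT2 (boolp.cid e).
Qed.

(** * Values of regular functions at the points of S *)

Definition eval2 (v : {ffun 'I_2 -> k}) : {poly {poly k}} -> k :=
  horner_eval (v 0) \o horner_eval (v 1)%:P.

HB.instance Definition _ v := GRing.RMorphism.on (eval2 v).

Lemma eval2C v (a : {poly k}) : eval2 v a%:P = a.[v 0].
Proof. by rewrite /eval2 /= /horner_eval hornerC. Qed.

Lemma eval2X v : eval2 v 'X = v 1.
Proof. by rewrite /eval2 /= /horner_eval hornerX hornerC. Qed.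

Lemma eval2B v p q : eval2 v (p - q) = eval2 v p - eval2 v q.
Proof. exact: rmorphB. Qed.

Lemma eval2_comp v p q :
  eval2 v (p \Po q) = eval2 [ffun i => if i == 0 then v 0 else eval2 v q] p.
Proof.
elim/poly_ind: p => [|p c IH]; first by rewrite comp_poly0 !rmorph0.
by rewrite comp_polyD comp_polyM comp_polyX comp_polyC !rmorphD !rmorphM /= IH
  eval2X !eval2C !ffunE.
Qed.

(** The value is read at the chosen representative; [value_chart] shows that every chart gives the
    same one. *)
Definition value (p : surface_points D) (h : CS) : k :=
  eval2 (repr p).2 (chart_fun (repr p).1 h).

(** Where x is nonzero, x^N h is a polynomial in x and u, and both keep their values under the
    gluing. *)
Lemma eval2_glue (h : CS) i j v w : glue (i, v) (j, w) ->
  eval2 v (chart_fun i h) = eval2 w (chart_fun j h).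
Proof.
rewrite /glue => /orP[/eqP[-> ->] //|/and3P[/= nz /eqP w0 /eqP w1]].
have [N [A HA]] := pull_x_mul_u h.
have /(mulfI (expf_neq0 N nz)) // : v 0 ^+ N * eval2 v (chart_fun i h) =
  v 0 ^+ N * eval2 w (chart_fun j h).
have e := fun l => congr1 (eval2 _) (HA l).
have := e v i; have := e w j; rewrite !rmorphM /= !eval2C !hornerXn w0 => -> ->.
rewrite !eval2_comp !chart_u_fun !rmorphD !rmorphM /= !eval2C !eval2X !hornerXn.
congr (eval2 _ A); apply/ffunP=> l; rewrite !ffunE; case: eqP => // _.
by rewrite w1 w0 mulrDr mulrCA divff ?expf_neq0 // mulr1 -addrA subrK.
Qed.

Lemma value_chart (h : CS) i v : value (chart i v) h = eval2 v (chart_fun i h).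
Proof.
rewrite /value; apply: eval2_glue; rewrite -surjective_pairing.
by apply/eqmodP; rewrite reprK.
Qed.

Lemma value_is_additive p : zmod_morphism (value p).
Proof. by move=> a b; rewrite /value !rmorphB. Qed.

Lemma value_is_multiplicative p : monoid_morphism (value p).
Proof. by split=> [|a b]; rewrite /value ?rmorph1 ?rmorphM. Qed.

HB.instance Definition _ p := GRing.isZmodMorphism.Build CS k
  (value p) (value_is_additive p).
HB.instance Definition _ p := GRing.isMonoidMorphism.Build CS k
  (value p) (value_is_multiplicative p).

Lemma chart_surj (p : surface_points D) : exists i v, p = chart i v.
Proof. by exists (repr p).1, (repr p).2; rewrite /chart -surjective_pairing reprK. Qed.

End CoordinateRing.

Lemma horner_subst_poly (A : comNzRingType) (S : comNzRingType)
    (iota : {rmorphism A -> S}) (p l : {poly A}) (t : S) :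
  (map_poly iota (p \Po l)).[t] = (map_poly iota p).[(map_poly iota l).[t]].
Proof. by rewrite map_comp_poly horner_comp. Qed.

(** * The isomorphism between S x A^1 and W x A^1 *)

Section Trivialization.
Variables (k : fieldType) (D : danielewski_data k).
Local Notation d := (origins D).
Local Notation n := (xdeg D).
Local Notation CS := (coord_ring D).
Local Notation x := (pull_x D 'X).

(** This and [pullB] are convertible to the coefficient maps in the definition of [Phi], but as
    composites they inherit a ring morphism structure. *)
Definition constB : k -> {poly CS} := polyC \o pull_x D \o polyC.
HB.instance Definition _ := GRing.RMorphism.on constB.

Definition pullB : {poly k} -> {poly CS} := polyC \o pull_x D.
HB.instance Definition _ := GRing.RMorphism.on pullB.

Variables (P : {poly k}) (c : k) (r : 'I_d -> k) (f : CS) (g : {poly {poly k}}).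
Variables (f1 q : 'I_d -> {poly {poly k}}).
Hypothesis c_neq0 : c != 0.
Hypothesis r_inj : injective r.
Hypothesis P_fact : P = c *: \prod_i ('X - (r i)%:P).
Hypothesis chart_f : forall i, chart_fun i f = (r i)%:P%:P + 'X%:P * f1 i.
Hypothesis g_subst : forall i,
  g \Po (((r i)%:P)%:P + 'X%:P * 'X) = (sigma i)%:P + ('X^n)%:P * q i.

Local Notation y_ := (Phi_y P f).
Local Notation z_ := (Phi_z f).
Local Notation w_ := (Phi_w f g).

(** The cofactor of z - r_i in P; its value at r_i is P'(r_i). *)
Definition Pquo (i : 'I_d) : {poly k} := c *: \prod_(j | j != i) ('X - (r j)%:P).

Lemma P_fact_at i : P = ('X - (r i)%:P) * Pquo i.
Proof. by rewrite P_fact (bigD1 i) //= scalerAr. Qed.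

Lemma Pquo_neq0 i : (Pquo i).[r i] != 0.
Proof.
rewrite hornerZ mulf_neq0 // horner_prod; apply/prodf_neq0=> j ji.
by rewrite hornerXsubC subr_eq0 (inj_eq r_inj) eq_sym.
Qed.

Lemma P_root z : P.[z] = 0 -> exists i, z = r i.
Proof.
rewrite P_fact hornerZ => /eqP; rewrite mulf_eq0 (negPf c_neq0) /= horner_prod.
by case/prodf_eq0=> i _; rewrite hornerXsubC subr_eq0 => /eqP; exists i.
Qed.

Lemma map_P_fact_at (S : comNzRingType) (iota : {rmorphism k -> S}) i t :
  (map_poly iota P).[t] = (t - iota (r i)) * (map_poly iota (Pquo i)).[t].
Proof.
by rewrite {1}(P_fact_at i) rmorphM /= hornerM rmorphB /= map_polyX map_polyC !hornerE.
Qed.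

Lemma map_g_subst (S : comNzRingType) (iota : {rmorphism {poly k} -> S})
    (l : {poly k} -> S) (iotaE : iota =1 l) i t :
  (map_poly iota g).[l (r i)%:P + l 'X * t] =
  l (sigma i) + l 'X ^+ n * (map_poly iota (q i)).[t].
Proof.
have := congr1 (fun p => (map_poly iota p).[t]) (g_subst i).
rewrite horner_subst_poly !rmorphD !rmorphM /= !map_polyC map_polyX /=.
by rewrite !hornerE -!iotaE => ->; rewrite rmorphXn.
Qed.

Lemma map_chart_z i :
  map_poly (chart_fun i) z_ = (r i)%:P%:P%:P + 'X%:P%:P * ((f1 i)%:P + 'X).
Proof.
rewrite /Phi_z rmorphD rmorphM /= !map_polyC map_polyX /= chart_f chart_pull_x.
by rewrite rmorphD rmorphM /=; ring.
Qed.

(** The division defining [Phi_y] is exact: on the i-th chart P(z) contains the factor z - r_i = x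
    (f_i + alpha). *)
Lemma mul_Phi_y : x%:P * y_ = (map_poly constB P).[z_].
Proof.
rewrite -[x%:P]expr1; apply: div_xP; apply: divide_x_poly => i.
exists (((f1 i)%:P + 'X) * map_poly (chart_fun i) (map_poly constB (Pquo i)).[z_]).
rewrite -[map_poly _ P]/(map_poly constB P) (map_P_fact_at _ i).
rewrite rmorphM rmorphB /= map_chart_z /constB /= map_polyC.
by rewrite /= chart_pull_x expr1; ring.
Qed.

(** On the i-th chart sigma_i cancels between u and g(x, z), which leaves x^n (u_i - q_i(x, f_i +
    alpha)). *)
Lemma mul_Phi_w : x%:P ^+ n * w_ = (u_fun D)%:P - (map_poly pullB g).[z_].
Proof.
apply: div_xP; apply: divide_x_poly => i.
pose iota := map_poly (chart_fun i) \o pullB.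
have iotaE a : iota a = a%:P%:P by rewrite /iota /= map_polyC /= chart_pull_x.
exists ('X%:P - (map_poly iota (q i)).[(f1 i)%:P + 'X]).
rewrite -[map_poly _ g]/(map_poly pullB g).
rewrite rmorphB /= -horner_map map_polyC /= chart_u_fun -map_poly_comp map_chart_z.
rewrite (map_g_subst iotaE i).
by rewrite !rmorphD !rmorphM /= rmorphXn /= rmorphXn; ring.
Qed.

Definition chart_at (i : 'I_d) (a : k) : {poly CS} -> {poly {poly k}} :=
  chart_fun i \o horner_eval (pull_x D a%:P).
HB.instance Definition _ i a := GRing.RMorphism.on (chart_at i a).

Lemma chart_atC i a h : chart_at i a h%:P = chart_fun i h.
Proof. by rewrite /chart_at /= /horner_eval hornerC. Qed.

Lemma chart_atX i a : chart_at i a 'X = a%:P%:P.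
Proof. by rewrite /chart_at /= /horner_eval hornerX chart_pull_x. Qed.

Lemma chart_at_z i a : chart_at i a z_ = (r i)%:P%:P + 'X%:P * (f1 i + a%:P%:P).
Proof.
by rewrite /Phi_z rmorphD rmorphM /= !chart_atC chart_atX chart_f chart_pull_x; ring.
Qed.

(** As [Phi_y] comes from a choice, its expression is found by cancelling x in [mul_Phi_y];
    [chart_at_w] likewise cancels x^n. *)
Lemma chart_at_y i a : chart_at i a y_ =
  (f1 i + a%:P%:P) * (map_poly (polyC \o polyC) (Pquo i)).[chart_at i a z_].
Proof.
have nz : 'X%:P != 0 :> {poly {poly k}} by rewrite polyC_eq0 polyX_eq0.
apply: (mulfI nz); have := congr1 (chart_at i a) mul_Phi_y.
rewrite rmorphM /= chart_atC chart_pull_x => ->.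
rewrite (map_P_fact_at _ i) rmorphM rmorphB /= chart_atC chart_pull_x.
have -> : chart_at i a z_ - (r i)%:P%:P = 'X%:P * (f1 i + a%:P%:P).
  by rewrite (chart_at_z i a) addrC addKr.
rewrite -!mulrA; congr (_ * (_ * _)).
rewrite -horner_map -map_poly_comp; congr (_.[_]); apply: eq_map_poly => b /=.
by rewrite chart_atC chart_pull_x.
Qed.

Lemma chart_at_w i a : chart_at i a w_ = 'X - (q i \Po (f1 i + a%:P%:P)).
Proof.
have nz : ('X^n)%:P != 0 :> {poly {poly k}} by rewrite polyC_eq0 monic_neq0 ?monicXn.
apply: (mulfI nz); have := congr1 (chart_at i a) mul_Phi_w.
rewrite rmorphM rmorphXn /= chart_atC chart_pull_x -rmorphXn /= => ->.
pose iota := chart_at i a \o pullB.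
have iotaE b : iota b = b%:P by rewrite /iota /= chart_atC chart_pull_x.
rewrite rmorphB /= chart_atC chart_u_fun -horner_map /= chart_at_z -map_poly_comp.
rewrite (map_g_subst iotaE i) (eq_map_poly iotaE).
by rewrite /comp_poly rmorphXn /=; ring.
Qed.

(** * The bijection from S x A^1 onto W x A^1 on points *)

Definition value_at (s : surface_points D) (a : k) : {poly CS} -> k :=
  value s \o horner_eval (pull_x D a%:P).
HB.instance Definition _ s a := GRing.RMorphism.on (value_at s a).

Lemma value_at_chart i v a b : value_at (chart i v) a b = eval2 v (chart_at i a b).
Proof. exact: value_chart. Qed.

Lemma value_atC s a h : value_at s a h%:P = value s h.
Proof. by rewrite /value_at /= /horner_eval hornerC. Qed.

Lemma value_pull_x s p : value s (pull_x D p) = p.[value s x].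
Proof.
by have [i [v ->]] := chart_surj s; rewrite !value_chart !chart_pull_x !eval2C hornerX.
Qed.

Lemma value_atX s a : value_at s a 'X = a.
Proof. by rewrite /value_at /= /horner_eval hornerX value_pull_x hornerC. Qed.

Lemma PhiE :
  Phi P f g = mmap constB (fun i : 'I_4 => [:: x%:P; y_; z_; w_]`_i).
Proof. by []. Qed.

HB.instance Definition _ := GRing.RMorphism.copy (Phi P f g)
  (mmap constB (fun i : 'I_4 => [:: x%:P; y_; z_; w_]`_i)).

Lemma PhiC a : Phi P f g a%:MP = constB a.
Proof. by rewrite PhiE mmapC. Qed.

Lemma PhiX i : Phi P f g 'X_i = [:: x%:P; y_; z_; w_]`_i.
Proof. by rewrite PhiE mmapX mmap1U. Qed.

Definition point (s : surface_points D) (a : k) : {ffun 'I_4 -> k} :=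
  [ffun i : 'I_4 => value_at s a [:: x%:P; y_; z_; w_]`_i].

Lemma value_at_Phi s a F : value_at s a (Phi P f g F) = F.@[point s a].
Proof.
pose ev := value_at s a \o Phi P f g; rewrite -[LHS]/(ev F).
apply: mpoly_rmorph_ext => [b|i] /=.
  by rewrite PhiC mevalC value_atC value_pull_x hornerC.
by rewrite PhiX mevalXU ffunE.
Qed.

Implicit Types (i j : 'I_d) (a : k) (v w : {ffun 'I_2 -> k}) (s : surface_points D).

Local Notation I0 := (@Ordinal 4 0 isT).
Local Notation I1 := (@Ordinal 4 1 isT).
Local Notation I2 := (@Ordinal 4 2 isT).
Local Notation I3 := (@Ordinal 4 3 isT).

Lemma ord4_ind (Q : 'I_4 -> Prop) :
  Q I0 -> Q I1 -> Q I2 -> Q I3 -> forall l : 'I_4, Q l.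
Proof.
by move=> Q0 Q1 Q2 Q3 [[|[|[|[|//]]]] lt]; rewrite (bool_irrelevance lt isT).
Qed.

Lemma value_chart_x i v : value (chart i v) x = v 0.
Proof. by rewrite value_chart chart_pull_x eval2C hornerX. Qed.

Lemma value_chart_u i v :
  value (chart i v) (u_fun D) = v 0 ^+ n * v 1 + (sigma i).[v 0].
Proof.
by rewrite value_chart chart_u_fun rmorphD rmorphM /= !eval2C eval2X hornerXn.
Qed.

(** Away from x = 0 the pair (x, u) separates points, whatever the charts. *)
Lemma chart_eq i j v w : v 0 != 0 -> w 0 = v 0 ->
  value (chart i v) (u_fun D) = value (chart j w) (u_fun D) ->
  chart i v = chart j w.
Proof.
move=> nz w0; rewrite !value_chart_u w0 => equ.
apply/eqmodP/orP; right; rewrite /= nz w0 eqxx /=; apply/eqP.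
apply: (mulfI (expf_neq0 n nz)); apply: (addIr (sigma j).[v 0]).
by rewrite -equ mulrDr mulrCA divff ?expf_neq0 // mulr1 -addrA subrK.
Qed.

Lemma chart_onto s i : value s x != 0 -> exists v, s = chart i v.
Proof.
have [j [w ->]] := chart_surj s; rewrite value_chart_x => nz.
(* The transition function from chart j to chart i. *)
exists [ffun l => if l == 0 then w 0
  else w 1 + ((sigma j).[w 0] - (sigma i).[w 0]) / w 0 ^+ n].
apply: chart_eq; rewrite ?ffunE // !value_chart_u !ffunE /=.
by rewrite mulrDr mulrCA divff ?expf_neq0 // mulr1 -addrA subrK.
Qed.

Lemma point_x s a : point s a I0 = value s x.
Proof. by rewrite ffunE /= value_atC. Qed.

Lemma point_z s a : point s a I2 = value s f + value s x * a.
Proof. by rewrite ffunE /= /Phi_z rmorphD rmorphM /= !value_atC value_atX. Qed.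

Lemma point_y s a : value s x * point s a I1 = P.[point s a I2].
Proof.
have := congr1 (value_at s a) mul_Phi_y.
rewrite rmorphM /= value_atC -horner_map -map_poly_comp !ffunE /= => ->.
congr _.[_]; apply: map_poly_id => b _ /=.
by rewrite value_atC value_pull_x hornerC.
Qed.

Lemma point_w s a : value s x ^+ n * point s a I3 =
  value s (u_fun D) - (map_poly (horner_eval (value s x)) g).[point s a I2].
Proof.
have := congr1 (value_at s a) mul_Phi_w.
rewrite rmorphM rmorphXn rmorphB /= !value_atC -horner_map -map_poly_comp.
rewrite !ffunE /= => ->.
congr (_ - _.[_]); apply: eq_map_poly => b /=.
by rewrite value_atC value_pull_x.
Qed.

Lemma point_eq_W s a : point s a I0 * point s a I1 = P.[point s a I2].
Proof. by rewrite point_x point_y. Qed.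

Lemma point_chart_y i v a : point (chart i v) a I1 =
  (eval2 v (f1 i) + a) * (Pquo i).[point (chart i v) a I2].
Proof.
rewrite !ffunE /= !(value_at_chart i v a) chart_at_y.
rewrite rmorphM rmorphD /= !eval2C hornerC.
congr (_ * _); rewrite -horner_map -map_poly_comp; congr _.[_].
apply: map_poly_id => b _ /=.
by rewrite eval2C hornerC.
Qed.

Lemma point_chart_w i v a : point (chart i v) a I3 =
  v 1 - eval2 [ffun l => if l == 0 then v 0 else eval2 v (f1 i) + a] (q i).
Proof.
rewrite ffunE /= (value_at_chart i v a) chart_at_w eval2B eval2_comp eval2X.
by rewrite rmorphD /= !eval2C hornerC.
Qed.

Lemma point_chart_z i v a : v 0 = 0 -> point (chart i v) a I2 = r i.
Proof.
move=> v0; rewrite !ffunE /= !(value_at_chart i v a) chart_at_z rmorphD rmorphM /=.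
by rewrite !eval2C hornerC hornerX v0 mul0r addr0.
Qed.

Lemma point_surj (p : 'I_4 -> k) : p I0 * p I1 = P.[p I2] ->
  exists s a, point s a =1 p.
Proof.
move=> eqp; have [p0|nz] := eqVneq (p I0) 0.
  have /P_root[i pi] : P.[p I2] = 0 by rewrite -eqp p0 mul0r.
  (* Over x = 0 the triangular map is inverted: y forces the value e of f_i + alpha, then w forces
     u_i = w + q_i(0, e). *)
  pose e := p I1 / (Pquo i).[r i].
  pose v : {ffun 'I_2 -> k} := [ffun l => if l == 0 then 0
    else p I3 + eval2 [ffun l => if l == 0 then 0 else e] (q i)].
  have v0 : v 0 = 0 by rewrite ffunE.
  exists (chart i v), (e - eval2 v (f1 i)); apply: ord4_ind.
  - by rewrite point_x value_chart_x v0 p0.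
  - rewrite point_chart_y point_chart_z // [_ + (_ - _)]addrC subrK.
    by rewrite /e divfK // Pquo_neq0.
  - by rewrite point_chart_z.
  - rewrite point_chart_w v0 [_ + (_ - _)]addrC subrK ffunE /= addrK.
    by [].
(* For x nonzero any chart serves: u = x^n w + g(x, z) gives u_i, and alpha = (z - f)/x. *)
pose i := Ordinal (ltnW (origins_ge2 D)).
pose v : {ffun 'I_2 -> k} := [ffun l => if l == 0 then p I0
  else (p I0 ^+ n * p I3 + (map_poly (horner_eval (p I0)) g).[p I2]
         - (sigma i).[p I0]) / p I0 ^+ n].
have v0 : v 0 = p I0 by rewrite ffunE.
have [a Ez] : exists a, point (chart i v) a I2 = p I2.
  exists ((p I2 - value (chart i v) f) / p I0).
  by rewrite point_z value_chart_x v0 mulrC divfK // addrC subrK.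
exists (chart i v), a; apply: ord4_ind.
- by rewrite point_x value_chart_x.
- apply: (mulfI nz); rewrite eqp -Ez.
  by rewrite -point_y value_chart_x v0.
- by [].
- have nzn : p I0 ^+ n != 0 by rewrite expf_neq0.
  apply: (mulfI nzn); rewrite -{1}v0 -(value_chart_x i) point_w value_chart_x v0 Ez.
  rewrite value_chart_u v0 [v 1]ffunE /= mulrC divfK //.
  by rewrite subrK addrK.
Qed.

(** If x is nonzero, w and z determine u. If x = 0, z = r_i determines the chart, y the value of
    f_i, and then w the coordinate u_i. *)
Lemma point_inj s s' a : point s a = point s' a -> s = s'.
Proof.
have [i [v ->]] := chart_surj s; have [j [w ->]] := chart_surj s' => eqp.
have e l : point (chart i v) a l = point (chart j w) a l by rewrite eqp.
have e0 := e I0; rewrite !point_x !value_chart_x in e0.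
have [v0|nz] := eqVneq (v 0) 0; last first.
  apply: chart_eq => //.
  apply: (subIr (map_poly (horner_eval (v 0)) g).[point (chart i v) a I2]).
  have := point_w (chart i v) a; rewrite value_chart_x => <-.
  by have := point_w (chart j w) a; rewrite value_chart_x -e0 -!e => <-.
have w0 : w 0 = 0 by rewrite -e0.
have := e I2; rewrite !point_chart_z // => /r_inj eij; subst j.
have := e I1; rewrite !point_chart_y !point_chart_z //.
move=> /(mulIf (Pquo_neq0 i)) eF.
have := e I3; rewrite !point_chart_w eF v0 w0 => /addIr v1.
congr (chart i _); apply/ffunP; case=> [[|[|//]] lt]; rewrite (bool_irrelevance lt isT).
  by have := e0; congr (v _ = w _); apply: val_inj.
by have := v1; congr (v _ = w _); apply: val_inj.
Qed.

(** * The image and the kernel of Phi *)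

Local Notation Phi_ := (Phi P f g).

Lemma eval_map_mpolyC (m : nat) (p : {poly k}) (F : {mpoly k[m]}) u :
  (map_poly (@mpolyC m k) p).[F].@[u] = p.[F.@[u]].
Proof.
rewrite -horner_map -map_poly_comp; congr _.[_].
by apply: map_poly_id => b _ /=; rewrite mevalC.
Qed.

Lemma meval_eq_W u : (eq_W P).@[u] = u I0 * u I1 - P.[u I2].
Proof. by rewrite /eq_W mevalB mevalM !mevalXU eval_map_mpolyC mevalXU. Qed.

Lemma Phi_horner (p : {poly k}) F :
  Phi_ (map_poly (@mpolyC 4 k) p).[F] = (map_poly constB p).[Phi_ F].
Proof.
rewrite -horner_map -map_poly_comp; congr _.[_].
by apply: eq_map_poly => b /=; rewrite PhiC.
Qed.

Lemma Phi_eq_W : Phi_ (eq_W P) = 0.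
Proof. by rewrite /eq_W rmorphB rmorphM /= Phi_horner !PhiX /= mul_Phi_y subrr. Qed.

Lemma Phi_eq_W_mul H : Phi_ (eq_W P * H) = 0.
Proof. by rewrite rmorphM /= Phi_eq_W mul0r. Qed.

Lemma P_in_roots : (map_poly (@mpolyC 4 k) P).['X_I2] =
  c%:MP * \prod_(z <- map r (enum 'I_d)) ('X_I2 - z%:MP).
Proof.
rewrite P_fact map_polyZ hornerZ rmorph_prod horner_prod big_map big_enum /=.
congr (_ * _); apply: eq_bigr => i _.
by rewrite rmorphB /= map_polyX map_polyC !hornerE.
Qed.

Hypothesis k_inf : forall s : seq k, exists z, z \notin s.

(** Roots are removed one at a time. The remainder of F at one root is divisible by x; the quotient
    vanishes over x = 0 at the other roots, where the removed linear factor is nonzero. *)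
Lemma mpoly_vanish_x0 (s : seq k) (F : {mpoly k[4]}) : uniq s ->
  (forall p : 'I_4 -> k, p I0 = 0 -> p I2 \in s -> F.@[p] = 0) ->
  exists G H, F = 'X_I0 * G + \prod_(z <- s) ('X_I2 - z%:MP) * H.
Proof.
elim: s F => [|z s IH] F /=.
  by exists 0, F; rewrite big_nil mulr0 add0r mul1r.
move=> /andP[zs us] F0; have [H1 eF] := mpoly_sub_subst I2 z F.
set F2 := F \mPo _ in eF.
have [G1 eF2] := mpoly_sub_subst I0 0 F2.
have F20 : F2 \mPo [tuple if j == I0 then (0 : k)%:MP else 'X_j | j < 4] = 0.
  apply: (mpoly_eq0_infinite k_inf) => p; rewrite !comp_mpoly_meval; apply: F0.
    by rewrite !(tnth_mktuple, mevalXU, mevalC).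
  by rewrite !(tnth_mktuple, mevalXU, mevalC) mem_head.
rewrite F20 add0r mpolyC0 subr0 in eF2.
have [|G [H eH]] := IH H1 us.
  move=> p p0 ps; have := F0 p p0; rewrite inE ps orbT => /(_ isT).
  rewrite eF eF2 mevalD !mevalM mevalB !mevalXU mevalC p0 mul0r add0r.
  move/eqP; rewrite mulf_eq0 => /orP[|/eqP//].
  by rewrite subr_eq0 => /eqP zp; rewrite -zp ps in zs.
exists (G1 + ('X_I2 - z%:MP) * G), H.
by rewrite eF eF2 eH big_cons; ring.
Qed.

Lemma Phi_divx F b : Phi_ F = x%:P * b ->
  exists G H, F = 'X_I0 * G + eq_W P * H.
Proof.
move=> eF; have [||G [H eG]] := @mpoly_vanish_x0 (map r (enum 'I_d)) F.
- by rewrite map_inj_uniq ?enum_uniq.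
- move=> p p0 /mapP[i _ p2].
  have [|s [a sa]] := point_surj (p := p).
    by rewrite p0 mul0r p2 (P_fact_at i) hornerM hornerXsubC subrr mul0r.
  rewrite -(meval_eq _ sa) -value_at_Phi eF rmorphM /= value_atC.
  by rewrite -(point_x s a) sa p0 mul0r.
(* The product of the linear factors is P(z)/c, and P(z) = xy - [eq_W P]. *)
exists (G + 'X_I1 * (c^-1%:MP * H)), (- (c^-1%:MP * H)).
have eH : H = c%:MP * (c^-1%:MP * H).
  by rewrite mulrA -mpolyCM divff // mpolyC1 mul1r.
rewrite {1}eG {1}eH mulrA [_ * c%:MP]mulrC -P_in_roots /eq_W; ring.
Qed.

(** Phi sends x^n w + g(x, z) to u, and x^N h is a polynomial in x and u. *)
Lemma Phi_clear_C (h : CS) : exists N F, Phi_ F = x%:P ^+ N * h%:P.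
Proof.
have [N [A hA]] := pull_x_mul_u h.
pose emb := horner_eval 'X_I0 \o map_poly (@mpolyC 4 k).
have emb_Phi p : Phi_ (emb p) = pullB p.
  rewrite /emb /= /horner_eval Phi_horner PhiX /=.
  elim/poly_ind: p => [|p b IH]; first by rewrite !rmorph0 horner0.
  rewrite !rmorphD !rmorphM /= hornerD hornerM IH map_polyX map_polyC !hornerC hornerX.
  by rewrite /pullB /constB /=.
exists N, (map_poly emb A).['X_I0 ^+ n * 'X_I3 + (map_poly emb g).['X_I2]].
have map_emb p T : Phi_ (map_poly emb p).[T] = (map_poly pullB p).[Phi_ T].
  by rewrite -horner_map -map_poly_comp; congr _.[_]; apply: eq_map_poly.
rewrite map_emb rmorphD rmorphM rmorphXn /= map_emb !PhiX /= mul_Phi_w subrK.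
have -> : x%:P ^+ N = (pull_x D 'X^N)%:P by rewrite !rmorphXn.
rewrite -polyCM /pullB map_poly_comp horner_map /=.
congr (_%:P); apply/chart_funP=> i.
rewrite rmorphM /= chart_pull_x hA -horner_map -map_poly_comp /comp_poly /=.
by congr _.[_]; apply: eq_map_poly => p /=; rewrite chart_pull_x.
Qed.

Lemma Phi_clear (b : {poly CS}) : exists N F, Phi_ F = x%:P ^+ N * b.
Proof.
elim/poly_ind: b => [|b h [N [F eF]]].
  by exists 0, 0; rewrite mulr0 rmorph0.
have [M [G eG]] := Phi_clear_C f; have [L [H eH]] := Phi_clear_C h.
(* Since G maps to x^M f, the factor x^M z - G maps to x^(M+1) alpha. *)
exists (N + M.+1 + L)%N,
  ('X_I0 ^+ L * (F * ('X_I0 ^+ M * 'X_I2 - G)) + 'X_I0 ^+ (N + M.+1) * H).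
rewrite !(rmorphD, rmorphM, rmorphXn, rmorphN) /= !PhiX /= eF eG eH /Phi_z.
by rewrite !exprD exprS; ring.
Qed.

(** Descent on the power of x in [Phi_clear]: [Phi_divx] removes one factor x at a time, up to a
    multiple of [eq_W P], which Phi kills. *)
Lemma Phi_surj b : exists F, Phi_ F = b.
Proof.
have [N [F eF]] := Phi_clear b; elim: N F eF => [|N IH] F eF.
  by exists F; rewrite eF mul1r.
have eF' : Phi_ F = x%:P * (x%:P ^+ N * b) by rewrite eF exprS mulrA.
have [G [H eG]] := Phi_divx eF'; apply: (IH G); apply: mulx_inj.
by rewrite -eF' eG [RHS]rmorphD /= Phi_eq_W_mul addr0 [RHS]rmorphM /= PhiX.
Qed.

(** Modulo xy - P(z), a power of x eliminates y. Freeness from y is expressed by substituting y = 0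
    in G. *)
Lemma eq_W_elim_y (F : {mpoly k[4]}) : exists N G H,
  'X_I0 ^+ N * F =
  (G \mPo [tuple if j == I1 then (0 : k)%:MP else 'X_j | j < 4]) + eq_W P * H.
Proof.
set lq := mktuple _; elim/mpoly_ring_ind: F => [b|l|F F' IH IH'|F F' IH IH'].
- by exists 0, b%:MP, 0; rewrite comp_mpolyC mulr0 addr0 mul1r.
- have [->|nl] := eqVneq l I1; last first.
    exists 0, 'X_l, 0; rewrite comp_mpolyXU -tnth_nth tnth_mktuple (negPf nl).
    by rewrite mulr0 addr0 mul1r.
  exists 1, (map_poly (@mpolyC 4 k) P).['X_I2], 1.
  rewrite -horner_map -map_poly_comp /= (eq_map_poly (g := @mpolyC 4 k)).
    by rewrite comp_mpolyXU -tnth_nth tnth_mktuple /= /eq_W; ring.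
  by move=> b; rewrite /= comp_mpolyC.
- case: IH IH' => N [G [H e]] [N' [G' [H' e']]].
  exists (N + N')%N, ('X_I0 ^+ N' * G + 'X_I0 ^+ N * G'),
    ('X_I0 ^+ N' * H + 'X_I0 ^+ N * H').
  have -> : 'X_I0 ^+ (N + N') * (F + F') =
      'X_I0 ^+ N' * ('X_I0 ^+ N * F) + 'X_I0 ^+ N * ('X_I0 ^+ N' * F').
    by rewrite exprD; ring.
  rewrite e e' rmorphD !rmorphM !rmorphXn /= comp_mpolyXU -tnth_nth tnth_mktuple.
  by ring.
- case: IH IH' => N [G [H e]] [N' [G' [H' e']]].
  exists (N + N')%N, (G * G'),
    ((G \mPo lq) * H' + H * (G' \mPo lq) + eq_W P * H * H').
  have -> : 'X_I0 ^+ (N + N') * (F * F') = ('X_I0 ^+ N * F) * ('X_I0 ^+ N' * F').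
    by rewrite exprD; ring.
  by rewrite e e' rmorphM /=; ring.
Qed.

Lemma P_neq0 : P != 0.
Proof.
apply/negP=> /eqP P0; have := Pquo_neq0 (Ordinal (ltnW (origins_ge2 D))).
set i := Ordinal _; have := P_fact_at i; rewrite P0 => /esym/eqP.
by rewrite mulf_eq0 polyXsubC_eq0 /= => /eqP->; rewrite horner0 eqxx.
Qed.

(** At x = 0 the equation reads 0 = -P(z) H, so H vanishes there and is divisible by x. *)
Lemma x_cancel_eq_W F H : 'X_I0 * F = eq_W P * H -> exists H', F = eq_W P * H'.
Proof.
move=> eF; have [H' eH] := mpoly_sub_subst I0 0 H.
set H0 := H \mPo _ in eH.
have PX_neq0 : (map_poly (@mpolyC 4 k) P).['X_I2] != 0.
  apply/negP=> /eqP PX0; have /eqP[] := P_neq0.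
  apply: (poly_eq0_infinite k_inf (e := id)) => // z.
  have := eval_map_mpolyC P 'X_I2 (fun=> z).
  by rewrite PX0 meval0 mevalXU.
have H00 : H0 = 0.
  apply: (mulfI PX_neq0); rewrite mulr0; apply: (mpoly_eq0_infinite k_inf) => p.
  pose p' (l : 'I_4) := if l == I0 then 0 else p l.
  have := congr1 (meval p') eF; rewrite !mevalM meval_eq_W mevalXU /p' /= !mul0r sub0r.
  move/esym/eqP; rewrite mulNr oppr_eq0 => /eqP <-.
  rewrite eval_map_mpolyC mevalXU comp_mpoly_meval; congr (_ * _).
  apply: meval_eq => l; rewrite tnth_mktuple; case: eqP => _.
    by rewrite mevalC.
  by rewrite mevalXU.
exists H'; have X_neq0 : 'X_I0 != 0 :> {mpoly k[4]} by rewrite mpolyXi_neq0.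
apply: (mulfI X_neq0); rewrite eF eH H00 mpolyC0; ring.
Qed.

(** The y-free form of x^N F vanishes wherever x is nonzero, because y = P(z)/x completes the other
    coordinates to a point of W x A^1. It is therefore zero, and x^N is cancelled. *)
Lemma vanish_eq_W F :
  (forall p : 'I_4 -> k, p I0 * p I1 = P.[p I2] -> F.@[p] = 0) ->
  exists H, F = eq_W P * H.
Proof.
move=> F0; have [N [G [H eF]]] := eq_W_elim_y F.
set G0 := G \mPo _ in eF.
have X_neq0 : 'X_I0 != 0 :> {mpoly k[4]} by rewrite mpolyXi_neq0.
have G00 : G0 = 0.
  (* The extra factor x makes the points with x = 0 harmless. *)
  apply: (mulfI X_neq0); rewrite mulr0; apply: (mpoly_eq0_infinite k_inf) => p.
  rewrite mevalM mevalXU; have [->|nz] := eqVneq (p I0) 0; first by rewrite mul0r.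
  pose p' (l : 'I_4) := if l == I1 then P.[p I2] / p I0 else p l.
  have p'W : p' I0 * p' I1 = P.[p' I2] by rewrite /p' /= mulrC divfK.
  have := congr1 (meval p') eF.
  rewrite mevalM F0 // mulr0 mevalD mevalM meval_eq_W p'W subrr mul0r addr0 => e.
  suff -> : G0.@[p] = G0.@[p'] by rewrite -e mulr0.
  rewrite !comp_mpoly_meval; apply: meval_eq => l; rewrite tnth_mktuple.
  by case: eqP => [_|/eqP nl]; rewrite ?mevalC // !mevalXU /p' (negPf nl).
rewrite G00 add0r in eF; elim: N H eF => [|N IH] H eF.
  by exists H; rewrite -eF mul1r.
have [|H' eH] := @x_cancel_eq_W ('X_I0 ^+ N * F) H; first by rewrite mulrA -exprS.
exact: IH eH.
Qed.

Lemma Phi_ker F : Phi_ F = 0 <-> exists H, F = H * eq_W P.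
Proof.
split=> [F0|[H ->]]; last by rewrite rmorphM /= Phi_eq_W mulr0.
have [p /point_surj[s [a sa]]|H eF] := @vanish_eq_W F; last first.
  by exists H; rewrite mulrC.
by rewrite -(meval_eq _ sa) -value_at_Phi F0 rmorph0.
Qed.

(** * The slices alpha = lambda *)

(** The charts of [surface] are affine planes with functions in [{mpoly k[2]}], whereas C[S] uses
    k[x][u]. This map and [mpoly_of_bipoly] translate between the two, and only values are
    compared. *)
Definition bipoly_of_mpoly : {mpoly k[2]} -> {poly {poly k}} :=
  mmap (polyC \o polyC) (fun l : 'I_2 => if l == 0 then 'X%:P else 'X).
HB.instance Definition _ := GRing.RMorphism.on bipoly_of_mpoly.

Lemma eval2_bipoly v p : eval2 v (bipoly_of_mpoly p) = p.@[v].
Proof.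
pose ev := eval2 v \o bipoly_of_mpoly; rewrite -[LHS]/(ev p).
apply: mpoly_rmorph_ext => [b|l] /=.
  by rewrite /bipoly_of_mpoly mmapC /= mevalC eval2C hornerC.
rewrite /bipoly_of_mpoly mmapX mmap1U mevalXU.
case: l => [[|[|//]] lt]; rewrite (bool_irrelevance lt isT) /=.
  by rewrite eval2C hornerX; congr (v _); apply: val_inj.
by rewrite eval2X; congr (v _); apply: val_inj.
Qed.

Definition mpoly_of_bipoly (p : {poly {poly k}}) : {mpoly k[2]} :=
  (map_poly (fun b => (map_poly (@mpolyC 2 k) b).['X_0]) p).['X_1].

Lemma meval_mpoly_of_bipoly v p : (mpoly_of_bipoly p).@[v] = eval2 v p.
Proof.
pose emb := horner_eval ('X_0 : {mpoly k[2]}) \o map_poly (@mpolyC 2 k).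
rewrite -[mpoly_of_bipoly p]/(map_poly emb p).['X_1] -horner_map -map_poly_comp /=.
rewrite mevalXU /eval2 /= /horner_eval.
rewrite -[RHS]/(horner_eval (v 0) p.[(v 1)%:P]) -horner_map /= /horner_eval hornerC.
congr _.[_]; apply: eq_map_poly => b.
by rewrite /= /horner_eval eval_map_mpolyC mevalXU.
Qed.

Lemma value_eq0 (h : CS) : (forall s, value s h = 0) -> h = 0.
Proof.
move=> h0; apply/chart_funP=> i; rewrite rmorph0.
apply: (poly_eq0_infinite k_inf (e := @polyC k)) => [|u]; first exact: polyC_inj.
apply: (poly_eq0_infinite k_inf (e := id)) => // z.
have := h0 (chart i [ffun l => if l == 0 then z else u]).
by rewrite value_chart /eval2 /= /horner_eval !ffunE.
Qed.

(* The second condition forces e to vanish on S outside the i-th chart. *)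
Lemma chart_principal i v : exists e : CS, value (chart i v) e != 0 /\
  forall j, j != i -> exists b, chart_fun j e = 'X%:P * b.
Proof.
have [v0|nz] := eqVneq (v 0) 0; last first.
  exists x; split=> [|j _]; first by rewrite value_chart_x.
  by exists 1; rewrite chart_pull_x mulr1.
(* As f = r_j on the j-th line, this product vanishes on every line but the i-th, where it is the
   product of the r_i - r_j. *)
exists (\prod_(j | j != i) (f - pull_x D (r j)%:P)); split=> [|j ji].
  rewrite rmorph_prod; apply/prodf_neq0 => j ji.
  rewrite rmorphB /= !value_chart chart_f chart_pull_x eval2C hornerC.
  rewrite rmorphD rmorphM /= !eval2C hornerC hornerX v0 mul0r addr0 subr_eq0.
  by rewrite (inj_eq r_inj) eq_sym.
rewrite (bigD1 j) //= rmorphM rmorphB /= chart_f chart_pull_x.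
rewrite [_ + _ - _]addrC addKr -mulrA; by eexists.
Qed.

Lemma value_principal i e s : value s e != 0 ->
  (forall j, j != i -> exists b, chart_fun j e = 'X%:P * b) ->
  exists v, s = chart i v.
Proof.
have [j [w ->]] := chart_surj s => nz He.
have [->|ji] := eqVneq j i; first by exists w.
apply: chart_onto; rewrite value_chart_x; have [b eb] := He j ji.
by move: nz; rewrite value_chart eb rmorphM /= eval2C hornerX mulf_eq0 => /norP[].
Qed.

(** Some x^N p extends to S as a polynomial h0 in x and u. Then e^N h0 is divisible by x^N on every
    chart: through h0 on the i-th, through e on the others. *)
Lemma chart_extend i e p :
  (forall j, j != i -> exists b, chart_fun j e = 'X%:P * b) ->
  exists N h, chart_fun i h = chart_fun i e ^+ N * p.
Proof.
move=> He; have [N [A eA]] := chart_clear_x i p.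
have [h0 eh0] : exists h0 : CS, chart_fun i h0 = ('X^N)%:P * p.
  exists (map_poly (pull_x D) A).[u_fun D].
  rewrite eA -horner_map -map_poly_comp /comp_poly; congr _.[_].
  by apply: eq_map_poly => b /=; rewrite chart_pull_x.
have [j|h eh] := @divide_x _ _ (e ^+ N * h0) N.
  rewrite rmorphM rmorphXn /=; have [->|ji] := eqVneq j i.
    by exists (chart_fun i e ^+ N * p); rewrite eh0 mulrCA.
  have [b ->] := He j ji; exists (b ^+ N * chart_fun j h0).
  by rewrite exprMn -!rmorphXn /= mulrA.
exists N, h; apply: (mulfI (_ : ('X^N)%:P != 0)).
  by rewrite polyC_eq0 monic_neq0 ?monicXn.
have /(congr1 (chart_fun i)) := eh.
by rewrite !rmorphM rmorphXn /= chart_pull_x eh0 mulrCA.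
Qed.

(** A common exponent lets the powers of e cancel in a fraction. *)
Lemma chart_extend2 i e p p' :
  (forall j, j != i -> exists b, chart_fun j e = 'X%:P * b) ->
  exists N h h', chart_fun i h = chart_fun i e ^+ N * p /\
                 chart_fun i h' = chart_fun i e ^+ N * p'.
Proof.
move=> He; have [N [h eh]] := chart_extend p He.
have [N' [h' eh']] := chart_extend p' He.
exists (N + N')%N, (e ^+ N' * h), (e ^+ N * h').
by rewrite !rmorphM !rmorphXn /= eh eh' exprD; split; ring.
Qed.

(** * The isomorphism of S with a slice *)

Section Slice.
Variables (lambda : k) (F : {mpoly k[4]}).
Hypothesis F_alpha : Phi_ F = 'X.
Local Notation E := [:: eq_W P; F - lambda%:MP].

Lemma meval_F s a : F.@[point s a] = a.
Proof. by rewrite -value_at_Phi F_alpha value_atX. Qed.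

Lemma point_in_locus s : in_zero_locus E (point s lambda).
Proof.
rewrite /in_zero_locus /= meval_eq_W point_eq_W subrr eqxx.
by rewrite mevalB mevalC meval_F subrr eqxx.
Qed.

(** Such a p has an image divisible by alpha - lambda in C[S][alpha]. Lifting the quotient through
    Phi leaves an element of the kernel. *)
Lemma slice_ideal p : (forall u, in_zero_locus E u -> p.@[u] = 0) ->
  ideal_gen E p.
Proof.
move=> p0; have rootp : root (Phi_ p) (pull_x D lambda%:P).
  apply/eqP/value_eq0 => s; have := value_at_Phi s lambda p.
  by rewrite p0 ?point_in_locus.
have /factor_theorem[b eb] := rootp; have [B eB] := Phi_surj b.
have /Phi_ker[H eH] : Phi_ (p - B * (F - lambda%:MP)) = 0.
  by rewrite rmorphB rmorphM rmorphB /= PhiC F_alpha eB -eb subrr.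
exists (fun l => [:: H; B]`_l); rewrite !big_ord_recl big_ord0 /= addr0.
by rewrite -eH subrK.
Qed.

Definition to_slice (s : surface D) : zero_locus E :=
  exist _ (point s lambda) (point_in_locus s).

Lemma to_slice_onto (u : zero_locus E) : exists s, to_slice s = u.
Proof.
case: u => u Eu; have /andP[/eqP uW /andP[/eqP uF _]] := Eu.
have [|s [a sa]] := @point_surj u.
  by apply/eqP; rewrite -subr_eq0 -meval_eq_W uW.
have ea : a = lambda.
  apply/eqP; rewrite -subr_eq0 -(meval_F s a) (meval_eq _ sa).
  by rewrite -[X in _ - X](mevalC u) -mevalB uF.
by exists s; apply: val_inj; apply/ffunP=> l; rewrite /= -ea sa.
Qed.

Lemma meval_to_slice p i v :
  p.@[val (to_slice (chart i v))] =
  (mpoly_of_bipoly (chart_at i lambda (Phi_ p))).@[v].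
Proof. by rewrite -value_at_Phi meval_mpoly_of_bipoly (value_at_chart i v). Qed.

Lemma lift_coord (h : CS) : exists p, forall s, p.@[val (to_slice s)] = value s h.
Proof.
have [p ep] := Phi_surj h%:P; exists p => s.
by rewrite -value_at_Phi ep value_atC.
Qed.

Lemma to_slice_open (U : zero_locus E -> Prop) :
  zopen U <-> zopen (fun s : surface D => U (to_slice s)).
Proof.
split=> [[Fam UFam] i|Uopen].
  pose on_chart p := mpoly_of_bipoly (chart_at i lambda (Phi_ p)).
  exists (fun t => exists2 p, Fam p & t = on_chart p).
  move=> v; rewrite UFam; split=> [[p Fp nz]|[_ [p Fp ->] nz]].
    by exists (on_chart p); [exists p|rewrite -meval_to_slice].
  by exists p => //; rewrite meval_to_slice.
(* The largest possible family; it remains to find a member that is nonzero at a given point of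
   U. *)
exists (fun p => forall s, p.@[val (to_slice s)] != 0 -> U (to_slice s)) => u.
have [s <-] := to_slice_onto u; split=> [|[p Up nz]]; last exact: Up.
have [i [v ->]] := chart_surj s => Us; have [Fam UFam] := Uopen i.
have [t Ft nzt] := (UFam v).1 Us.
have [e [nze He]] := chart_principal i v.
have [N [h eh]] := chart_extend (bipoly_of_mpoly t) He.
(* The exponent N may be 0, so the extra factor e is what confines the nonvanishing set to the i-th
   chart. *)
have [p ep] := lift_coord (e * h); exists p => [s'|]; rewrite ep rmorphM /= mulf_eq0.
  move=> /norP[nze' nzh']; have [v' es'] := value_principal nze' He.
  rewrite es' in nze' nzh' *; apply/(UFam v'); exists t => //.
  by move: nzh'; rewrite value_chart eh rmorphM /= eval2_bipoly mulf_eq0 => /norP[].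
rewrite negb_or nze /= value_chart eh rmorphM rmorphXn /= eval2_bipoly.
by rewrite mulf_neq0 // expf_neq0 // -value_chart.
Qed.

Lemma to_slice_regular (U : zero_locus E -> Prop) (h : zero_locus E -> k) :
  regular U h <->
  regular (fun s : surface D => U (to_slice s)) (fun s => h (to_slice s)).
Proof.
split=> [reg i v Uv|reg u].
  have [a [b [nzb hab]]] := reg _ Uv.
  exists (mpoly_of_bipoly (chart_at i lambda (Phi_ a))),
    (mpoly_of_bipoly (chart_at i lambda (Phi_ b))).
  split=> [|w Uw]; first by rewrite -meval_to_slice.
by have := hab _ Uw; rewrite (meval_to_slice a i w) (meval_to_slice b i w).
have [s <-] := to_slice_onto u; have [i [v ->]] := chart_surj s => Uv.
have [a [b [nzb hab]]] := reg i v Uv.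
have [e [nze He]] := chart_principal i v.
have [N [ha [hb [eha ehb]]]] :=
  chart_extend2 (bipoly_of_mpoly a) (bipoly_of_mpoly b) He.
(* On the i-th chart A/B is a/b with e^(N+1) in both terms, and B is zero outside that chart. *)
have [A eA] := lift_coord (e * ha); have [B eB] := lift_coord (e * hb).
exists A, B; split=> [|u' Uu'].
  rewrite eB rmorphM /= mulf_neq0 // value_chart ehb rmorphM rmorphXn /= eval2_bipoly.
  by rewrite mulf_neq0 // expf_neq0 // -value_chart.
have [s' es'] := to_slice_onto u'; rewrite -es' in Uu' *.
rewrite eA eB !rmorphM /= mulf_eq0 => /norP[nze' nzb'].
have [w ew] := value_principal nze' He; rewrite ew in Uu' nze' nzb' *.
move: nzb'; rewrite !value_chart eha ehb !rmorphM rmorphXn /= !eval2_bipoly.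
rewrite mulf_eq0 => /norP[nzN nzb']; rewrite hab // -value_chart in nzN *.
by rewrite -mulf_div divff // mul1r -mulf_div divff // mul1r.
Qed.

Lemma slice_iso : isomorphic_to_subscheme (surface D) E.
Proof.
split; last exact: slice_ideal.
pose from_slice u := projT1 (boolp.cid (to_slice_onto u)).
have fromK : cancel from_slice to_slice.
  by move=> u; rewrite /from_slice; case: boolp.cid.
exists to_slice, from_slice; split=> //.
- move=> s; apply: (@point_inj _ _ lambda).
  by have /(congr1 val) := fromK (to_slice s).
- exact: to_slice_open.
- by move=> U h _; apply: to_slice_regular.
Qed.

End Slice.

Lemma Phi_induces_iso : induces_iso [:: eq_W P] Phi_.
Proof.
split=> [b|F]; first exact: Phi_surj.
rewrite Phi_ker; split=> [[H ->]|[h ->]].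
  by exists (fun=> H); rewrite big_ord_recl big_ord0 addr0.
by exists (h ord0); rewrite big_ord_recl big_ord0 addr0.
Qed.

End Trivialization.

(** * Extracting the data from the hypotheses of the theorem *)

Lemma bipoly_mod_x (k : fieldType) (p : {poly {poly k}}) :
  exists q, p = map_poly polyC (map_poly (horner_eval 0) p) + 'X%:P * q.
Proof.
elim/poly_ind: p => [|p a [q IH]].
  by exists 0; rewrite !rmorph0 mulr0 addr0.
have /factor_theorem[b eb] : root (a - a.[0]%:P) 0.
  by rewrite /root !hornerE subrr.
exists (q * 'X + b%:P).
have ea : a = a.[0]%:P + b * 'X.
  by move: eb; rewrite polyC0 subr0 => <-; rewrite [RHS]addrC subrK.
rewrite {1}ea {1}IH !rmorphD !rmorphM /= !map_polyX !map_polyC /= /horner_eval.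
ring.
Qed.

Lemma num_infinite (k : numDomainType) (s : seq k) : exists z, z \notin s.
Proof.
(* One more natural number than s has entries; they are distinct in characteristic 0. *)
pose t : seq k := [seq m%:R | m <- iota 0 (size s).+1].
have [/allP ts|/allPn[z _ zs]] := boolP (all (mem s) t); last by exists z.
have ut : uniq t.
  rewrite map_inj_uniq ?iota_uniq // => a b /eqP.
  by rewrite Num.Theory.eqr_nat => /eqP.
by have := uniq_leq_size ut ts; rewrite size_map size_iota ltnn.
Qed.

Theorem corollary4p0p1 (R : realType) (D : danielewski_data R[i])
  (P : {poly R[i]}) (r : 'I_(origins D) -> R[i])
  (f : coord_ring D) (g : {poly {poly R[i]}})
  (size_P : size P = (origins D).+1)
  (r_inj : injective r)
  (r_root : forall i, root P (r i))
  (f_line : forall i, restrict_line f i = (r i)%:P)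
  (g_sigma : forall i, exists q : {poly {poly R[i]}},
     g \Po (((r i)%:P)%:P + 'X%:P * 'X) - (sigma i)%:P = ('X^(xdeg D))%:P * q) :
  induces_iso [:: eq_W P] (Phi P f g) /\
  forall (lambda : R[i]) (F : {mpoly R[i][4]}),
    Phi P f g F = 'X ->
    isomorphic_to_subscheme (surface D) [:: eq_W P; F - lambda%:MP].
Proof.
have P_fact : P = lead_coef P *: \prod_i ('X - (r i)%:P).
  rewrite {1}(@all_roots_prod_XsubC _ P (map r (enum 'I_(origins D)))).
  - by rewrite big_map big_enum.
  - by rewrite size_map size_enum_ord.
  - by apply/allP=> _ /mapP[i _ ->].
  - by rewrite uniq_rootsE map_inj_uniq ?enum_uniq.
have P_lead : lead_coef P != 0 by rewrite lead_coef_eq0 -size_poly_eq0 size_P.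
(* The condition that f equals r_i on the i-th line says that f - r_i is divisible by x on that
   chart. *)
have /fin_all_exists[f1 chart_f] : forall i, exists q,
    chart_fun i f = (r i)%:P%:P + 'X%:P * q.
  move=> i; have [q eq_q] := bipoly_mod_x (chart_fun i f); exists q.
  have f_i : map_poly (horner_eval 0) (chart_fun i f) = (r i)%:P := f_line i.
  by rewrite eq_q f_i map_polyC.
have /fin_all_exists[q g_subst] : forall i, exists q,
    g \Po (((r i)%:P)%:P + 'X%:P * 'X) = (sigma i)%:P + ('X^(xdeg D))%:P * q.
  by move=> i; have [q eq_q] := g_sigma i; exists q; rewrite -eq_q [RHS]addrC subrK.
have R_inf := @num_infinite R[i].
split; first exact: (Phi_induces_iso P_lead r_inj P_fact chart_f g_subst R_inf).
by move=> lambda F; apply: (slice_iso P_lead r_inj P_fact chart_f g_subst R_inf).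
Qed.
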